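(* Let $G$ be a finite group and let $H$ be a non-trivial subgroup of $G$. Then $H$ is a perfect code of $G$ if and only if $H$ is an $(a,b)$-regular set of $G$ for every pair of integers $a,b$ with $0\leq a\leq |H|-1$ and $0\leq b\leq |H|$ such that $\gcd(2,|H|-1)$ divides $a$.
   Context: For a finite group $G$ and an inverse-closed subset $S$ of $G\setminus\{1\}$ (i.e. $s\in S$ implies $s^{-1}\in S$), the Cayley graph $\mathrm{Cay}(G,S)$ is the simple graph with vertex set $G$ in which $x,y\in G$ are adjacent if and only if $yx^{-1}\in S$. For non-negative integers $a,b$, a subset $C$ of the vertex set of a simple graph $\Gamma$ is an $(a,b)$-regular set in $\Gamma$ if every vertex of $C$ is adjacent to exactly $a$ vertices of $C$ and every vertex outside $C$ is adjacent to exactly $b$ vertices of $C$. A perfect code of $\Gamma$ is a $(0,1)$-regular set in $\Gamma$. A subset $C$ of $G$ is called an $(a,b)$-regular set of $G$ if it is an $(a,b)$-regular set in $\mathrm{Cay}(G,S)$ for some inverse-closed subset $S$ of $G\setminus\{1\}$ (where $S$ may depend on $a$ and $b$); it is called a perfect code of $G$ if it is a $(0,1)$-regular set of $G$. *)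

(* Defs.v *)
From mathcomp Require Import all_boot all_fingroup.

Set Implicit Arguments.
Unset Strict Implicit.
Unset Printing Implicit Defensive.

(* A graph is given by a vertex set V and a relation e; only the restriction  *)
(* of e to V matters.                                                         *)
Definition simple_graph (T : finType) (V : {set T}) (e : rel T) : Prop :=
  {in V &, symmetric e} /\ {in V, irreflexive e}.

Definition regular_set (T : finType) (V : {set T}) (e : rel T)
    (a b : nat) (C : {set T}) : Prop :=
  [/\ C \subset V,
      forall x, x \in C -> #|[set y in C | e x y]| = a
    & forall x, x \in V :\: C -> #|[set y in C | e x y]| = b].

Definition connection_set (gT : finGroupType) (G S : {set gT}) : Prop :=
  S \subset G :\ 1%g /\ (forall s, s \in S -> s^-1%g \in S).

Definition cayley (gT : finGroupType) (S : {set gT}) : rel gT :=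
  fun x y => (y * x^-1)%g \in S.

Lemma cayley_simple (gT : finGroupType) (G : {group gT}) (S : {set gT}) :
  connection_set G S -> simple_graph G (cayley S).
Proof.
case=> /subsetP sSG SV; split=> [x y _ _ | x _]; rewrite /cayley.
  by apply/idP/idP=> /SV; rewrite invMg invgK.
by rewrite mulgV; apply/negP=> /sSG; rewrite !inE eqxx.
Qed.

Definition group_regular_set (gT : finGroupType) (G : {set gT})
    (a b : nat) (C : {set gT}) : Prop :=
  exists S : {set gT}, connection_set G S /\ regular_set G (cayley S) a b C.

Definition group_perfect_code (gT : finGroupType) (G C : {set gT}) : Prop :=
  group_regular_set G 0 1 C.

(* Main.v *)
(** A subgroup H is a perfect code of Cay(G,S) exactly when S is disjoint from H
    and meets each right coset of H in G \ H exactly once; an (a,b)-regular H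
    needs a elements of S in H and b in each other coset.  The a elements exist
    because H \ {1} has an involution when a is odd (|H| is then even).  The b
    elements per coset are produced separately on each E = HxH u Hx^-1H.
    If HxH <> Hx^-1H, the code restricts to a common left and right transversal
    T of HxH, and T B u (T B)^-1 works for any B \subset H with |B| = b.
    If HxH = Hx^-1H, view d as an arc from Hd to Hd^-1: this is a complete
    digraph on the n right cosets in HxH with constant arc multiplicity m
    (nm = |H|) in which inversion reverses arcs, so one needs a symmetric n x n
    matrix with entries at most m and row sums b, whose diagonal entries are
    even if HxH has no involution.  In that last case n and m are even: the code
    pairs up the n cosets, and inversion pairs up the m loops at a coset. *)

Require Import Defs.
From mathcomp Require Import all_boot all_fingroup zify.

Set Implicit Arguments.
Unset Strict Implicit.
Unset Printing Implicit Defensive.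

(** * Inverse-closed sets and selections from them *)

Definition inv_closed (gT : finGroupType) (S : {set gT}) : Prop :=
  forall s, (s^-1 \in S)%g = (s \in S).

(** If no element is its own inverse, [X] is the disjoint union of [A] and the inverse of [A], where
    [A] keeps from each pair the element enumerated first. *)
Lemma inv_closed_odd (gT : finGroupType) (X : {set gT}) :
  inv_closed X -> odd #|X| -> exists2 t, t \in X & (t^-1)%g = t.
Proof.
move=> XV; case: (pickP [pred t in X | t^-1 == t]%g) => [t /andP[tX /eqP tV]|noinv].
  by exists t.
pose A := [set x in X | enum_rank x < enum_rank (x^-1)%g].
have memAV x : (x \in A^-1)%g = (x \in X) && (enum_rank (x^-1)%g < enum_rank x).
  by rewrite mem_invg inE XV invgK.
have -> : X = A :|: (A^-1)%g.
  apply/setP=> x; rewrite in_setU memAV !inE -andb_orr -neq_ltn.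
  have := noinv x; rewrite /= ; case: (x \in X) => //= neq.
  rewrite eq_sym; apply/esym/eqP => /val_inj/enum_rank_inj e.
  by move: neq; rewrite e eqxx.
rewrite cardsU disjoint_setI0 ?cards0 ?subn0 ?card_invg ?addnn ?odd_double //.
apply/pred0P=> x; rewrite /= memAV !inE.
by case: (x \in X) => //=; apply/negP => /andP[/ltn_trans H /H]; rewrite ltnn.
Qed.

Lemma subset_of_card (T : finType) (X : {set T}) (k : nat) :
  k <= #|X| -> exists2 Y : {set T}, Y \subset X & #|Y| = k.
Proof.
move=> leX; exists [set x in take k (enum X)].
  by apply/subsetP=> x; rewrite inE => /mem_take; rewrite mem_enum.
rewrite cardsE; have /card_uniqP -> := take_uniq k (enum_uniq X).
by rewrite size_takel // -cardE.
Qed.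

(** Pairs {x, x^-1} of distinct elements are split off two units of [k] at a time; once none is
    left, inversion fixes [X] pointwise and any subset serves. The self-inverse element lies in no
    such pair and supplies the last unit of an odd [k]. *)
Lemma inv_closed_subset (gT : finGroupType) (k : nat) (X : {set gT}) :
    inv_closed X -> k <= #|X| ->
    (odd k -> exists2 t, t \in X & (t^-1)%g = t) ->
  exists Y : {set gT}, [/\ Y \subset X, inv_closed Y & #|Y| = k].
Proof.
elim/ltn_ind: k X => -[|[|k]] IH X XV leX oddX.
- by exists set0; rewrite sub0set cards0; split=> // s; rewrite !inE.
- case: oddX => // t tX tV; exists [set t]; rewrite sub1set cards1; split=> // s.
  by rewrite !inE -{1}tV (inj_eq invg_inj).
case: (pickP [pred x in X | x^-1 != x]%g) => [x /andP[xX xV]|inv]; last first.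
  have invX x : x \in X -> (x^-1 = x)%g.
    by move=> xX; have := inv x; rewrite /= xX => /negbFE/eqP.
  have [Y sYX cardY] := subset_of_card leX; exists Y; split=> // s.
  have [sX|sX] := boolP (s \in X); first by rewrite invX.
  by rewrite !(contraNF (subsetP sYX _)) // XV.
have xVX : (x^-1)%g \in X by rewrite XV.
pose P := [set x; x^-1%g].
have PV : inv_closed P.
  by move=> s; rewrite !inE (inj_eq invg_inj) -eq_invg_sym orbC (canF_eq invgK) orbC.
have sPX : P \subset X by rewrite subUset !sub1set xX.
have cardP : #|P| = 2 by rewrite cards2 eq_sym xV.
have cardXP : #|X| = 2 + #|X :\: P| by rewrite -(cardsID P X) (setIidPr sPX) cardP.
have [| | |Y [sY YV cardY]] := IH k (ltnW (ltnSn _)) (X :\: P).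
- by move=> s; rewrite !(in_setD) PV XV.
- by lia.
- move=> ok; have [|t tX tV] := oddX; first by rewrite /= ok.
  exists t => //; rewrite !inE tX andbT negb_or.
  have tx : t != x by apply: contraNneq xV => <-; rewrite tV.
  by rewrite tx -tV (inj_eq invg_inj) tx.
have disYP : [disjoint Y & P] by move: sY; rewrite subsetD => /andP[].
exists (Y :|: P); split.
- by rewrite subUset sPX (subset_trans sY) ?subsetDl.
- by move=> s; rewrite in_setU YV PV -in_setU.
- by rewrite cardsU disjoint_setI0 // cards0 cardY cardP subn0 addn2.
Qed.

(* The elements [d] of [D] are seen as arcs from [f d] to [f d^-1]. *)
Lemma symmetric_selection (gT : finGroupType) (n : nat) (D : {set gT})
    (f : gT -> 'I_n) (N : 'I_n -> 'I_n -> nat) :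
    inv_closed D -> (forall i j, N i j = N j i) ->
    (forall i j, N i j <= #|[set d in D | (f d == i) && (f d^-1%g == j)]|) ->
    (forall i, odd (N i i) -> exists t, [/\ t \in D, f t = i & t^-1%g = t]) ->
  exists S : {set gT}, [/\ S \subset D, inv_closed S
    & forall i, #|[set d in S | f d == i]| = \sum_j N i j].
Proof.
move=> DV Nsym leN oddN.
pose arcs i j := [set d in D | (f d == i) && (f d^-1%g == j)].
have arcsV i j : ((arcs i j)^-1)%g = arcs j i.
  by apply/setP=> d; rewrite mem_invg !inE DV invgK [X in _ && X]andbC.
(* For i <> j, a set [A] of arcs from i to j is completed by the reversed arcs, which run from j to
   i and leave the count in [arcs i j] unchanged. *)
have selP (p : 'I_n * 'I_n) :
    exists F : {set gT}, inv_closed F /\ #|F :&: arcs p.1 p.2| = N p.1 p.2.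
  case: p => i j /=; have [<-|neq] := eqVneq i j.
    have [| | |Y [sY YV cY]] := @inv_closed_subset _ (N i i) (arcs i i).
    - by move=> s; rewrite -mem_invg arcsV.
    - exact: leN.
    - by move=> /oddN[t [tD ft tV]]; exists t => //; rewrite inE tD tV ft eqxx.
    by exists Y; rewrite (setIidPl sY).
  have [A sA cA] := subset_of_card (leN i j).
  exists (A :|: A^-1)%g; split=> [s|]; first by rewrite !in_setU !mem_invg invgK orbC.
  rewrite setIUl (setIidPl sA).
  rewrite (_ : A^-1 :&: _ = set0)%g ?setU0 //; apply/setP => d; rewrite !inE.
  apply/negP => /andP[/(subsetP sA)]; rewrite !inE invgK => /and3P[_ _ /eqP->].
  by case/and3P=> _ /eqP ji; rewrite ji eqxx in neq.
have [F FP] := fin_all_exists selP.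
(* One choice per unordered pair governs both directions, which makes [S] closed under inversion. *)
pose key (i j : 'I_n) := if i <= j then (i, j) else (j, i).
have keyC i j : key i j = key j i.
  by rewrite /key; case: ltngtP => // /val_inj ->.
have cardF i j : #|F (key i j) :&: arcs i j| = N i j.
  rewrite /key; case: ifP => _; first by case: (FP (i, j)).
  case: (FP (j, i)) => FV /=; rewrite Nsym => <-.
  rewrite -(arcsV i j) -(card_invg (_ :&: arcs i j)); apply: eq_card => d.
  by rewrite mem_invg !in_setI FV mem_invg.
pose S := [set d in D | d \in F (key (f d) (f d^-1%g))].
exists S; split.
- by apply/subsetP=> d; rewrite inE => /andP[].
- by move=> d; rewrite !inE DV invgK keyC; congr andb; case: (FP (key (f d) (f d^-1%g))).
move=> i; rewrite -sum1_card (partition_big (fun d => f d^-1%g) predT) //=.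
apply: eq_bigr => j _; rewrite -cardF sum1_card; apply: eq_card => d.
rewrite -topredE /= !inE; have [<-|] := eqVneq (f d) i; last by rewrite !(andbF, andbT).
by have [<-|] := eqVneq (f d^-1%g) j; rewrite !(andbF, andbT) // andbC.
Qed.

(** * Symmetric matrices with constant row sums *)

Lemma sum_ord_ltn (n s : nat) : \sum_(j < n) (j < s) = minn n s.
Proof.
elim: n => [|n IH]; first by rewrite big_ord0 min0n.
by rewrite big_ord_recr /= IH; lia.
Qed.

(** For fixed [i], j -> (i + j) mod n permutes the indices. *)
Lemma sum_modn_ltn (n s : nat) (i : 'I_n) :
  s <= n -> \sum_(j < n) ((i + j) %% n < s) = s.
Proof.
case: n i => [[] //|n] i les.
have inj : injective (fun j : 'I_n.+1 => inord ((i + j) %% n.+1) : 'I_n.+1).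
  move=> j k /(congr1 val); rewrite /= !inordK ?ltn_pmod // => /eqP.
  by rewrite eqn_modDl !modn_small // => /eqP/val_inj.
rewrite -[RHS](minn_idPr les) -sum_ord_ltn [RHS](reindex_inj inj).
by apply: eq_bigr => j _; rewrite inordK ?ltn_pmod.
Qed.

(** With b = qn + s, the entries q + [(i + j) mod n < s] depend on i + j only, hence are symmetric.
    If odd diagonal entries are forbidden, the same is done with the halves of [b] and [m] and
    doubled; an odd [b] gets its last unit from the antidiagonal, which misses the diagonal because
    [n] is even. *)
Lemma selection_matrix (n m b : nat) (loops : bool) :
    0 < n -> b <= n * m -> (~~ loops -> ~~ odd n && ~~ odd m) ->
  exists N : 'I_n -> 'I_n -> nat,
    [/\ forall i j, N i j = N j i, forall i j, N i j <= m,
        forall i, odd (N i i) -> loops & forall i, \sum_j N i j = b].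
Proof.
move=> n0 leb; case: loops => [_|/(_ isT)/andP[on om]].
  have sn := ltn_pmod b n0; have qs := divn_eq b n.
  exists (fun i j : 'I_n => b %/ n + ((i + j) %% n < b %% n)).
  split=> // [i j|i j|i]; first by rewrite addnC [(j + i)%N]addnC addnC.
    by case: ltnP => ?; nia.
  by rewrite big_split /= sum_nat_const card_ord sum_modn_ltn ?(ltnW sn) //; lia.
have sn := ltn_pmod b./2 n0; have qs := divn_eq b./2 n.
set q := b./2 %/ n in qs; set s := b./2 %% n in qs sn.
have bE := odd_double_half b; have mE := odd_double_half m.
have nE := odd_double_half n.
clearbody q s; move: (b./2) (m./2) qs bE mE => c p qs bE mE.
have mN : n * m = (n * p).*2 by rewrite doubleMr -[in LHS]mE (negbTE om).
have qm : q <= p by rewrite -(leq_pmul2l n0); lia.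
(* If a row needs more than 2qn, then 2qn < b <= 2np, so an entry 2q can still grow by 2. *)
have ltqm : 0 < s + odd b -> q < p by move=> ?; rewrite -(ltn_pmul2l n0); lia.
(* The entries with [i + j = n - 1] form a fixed-point-free matching avoiding
   [(i + j) %% n < s], so there is room for one more when [b] is odd. *)
exists (fun i j : 'I_n =>
  (q + ((i + j) %% n < s)).*2 + odd b * (i + j == n.-1)); split=> [i j|i j|i|i].
- by rewrite [(j + i)%N]addnC.
- case: eqP => [ij|_]; last first.
    by rewrite muln0 addn0; case: ltnP => ?; lia.
  by rewrite ij modn_small ?ltn_predL // ltnNge (_ : s <= n.-1) /=; lia.
- by rewrite oddD odd_double; case: eqP => ?; rewrite ?muln0 //; lia.
under eq_bigr do rewrite -muln2.
rewrite big_split -big_distrl big_split /= sum_nat_const card_ord -big_distrr /=.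
rewrite sum_modn_ltn ?(ltnW sn) // (bigD1 (rev_ord i)) //= big1 => [|j].
  by have := ltn_ord i; case: eqP => ?; lia.
by rewrite -val_eqE /= => ?; case: eqP => //; lia.
Qed.

(** * Double cosets of [H] and selections inside them *)

Section DoubleCosets.

Variables (gT : finGroupType) (H : {group gT}).
Implicit Types (x y : gT) (D : {set gT}).

Lemma mem_dcoset x y :
  reflect (exists h k, [/\ h \in H, k \in H & y = h * x * k]%g) (y \in H :* x * H)%g.
Proof.
apply: (iffP mulsgP) => [[u k /rcosetP[h hH ->] kH ->]|[h [k [hH kH ->]]]].
  by exists h, k.
by exists (h * x)%g k; rewrite ?mem_rcoset ?mulgK.
Qed.

Lemma dcoset_refl x : (x \in H :* x * H)%g.
Proof. by apply/mem_dcoset; exists 1%g, 1%g; rewrite !group1 mul1g mulg1. Qed.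

Lemma dcoset_stable x y h k :
  h \in H -> k \in H -> (y \in H :* x * H -> h * y * k \in H :* x * H)%g.
Proof.
move=> hH kH /mem_dcoset[h1 [k1 [h1H k1H ->]]]; apply/mem_dcoset.
by exists (h * h1)%g, (k1 * k)%g; rewrite !groupM // !mulgA.
Qed.

(** If y = h1 x k1 and z = h2 x k2, then u -> h2 u k1 carries the intersection of Hx and xH onto
    that of Hy and zH. *)
Lemma card_rcosetI_lcoset x y z :
  (y \in H :* x * H -> z \in H :* x * H ->
   #|(H :* y) :&: (z *: H)| = #|(H :* x) :&: (x *: H)|)%g.
Proof.
move=> /mem_dcoset[h1 [k1 [h1H k1H ->]]] /mem_dcoset[h2 [k2 [h2H k2H ->]]].
rewrite -[RHS](card_rcoset _ k1) -[RHS](card_lcoset _ h2); apply: eq_card => u.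
rewrite [RHS]mem_lcoset [in RHS]mem_rcoset !in_setI !mem_rcoset !mem_lcoset !invMg !mulgA.
rewrite (groupMr _ (groupVr h1H)) [in RHS](groupMr _ (groupVr k1H)) -!mulgA.
by rewrite (groupMl _ (groupVr k2H)) [in RHS](groupMl _ (groupVr h2H)).
Qed.

Lemma dcoset_trans x y z :
  (y \in H :* x * H -> z \in H :* x * H -> z \in H :* y * H)%g.
Proof.
case/mem_dcoset=> h [k [hH kH ->]] /mem_dcoset[h' [k' [h'H k'H ->]]].
apply/mem_dcoset; exists (h' * h^-1)%g, (k^-1 * k')%g.
by rewrite !groupM ?groupV // !mulgA mulgKV -!mulgA mulKVg.
Qed.

Lemma card_rcosetV (S : {set gT}) y :
  #|(S^-1 :&: (H :* y))%g| = #|(S :&: (y^-1 *: H))%g|.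
Proof.
rewrite -card_invg; apply: eq_card => d.
rewrite mem_invg !in_setI mem_invg invgK mem_rcoset mem_lcoset.
by rewrite -[in RHS]groupV invMg !invgK.
Qed.

Definition coset_regular (b : nat) (U S : {set gT}) : Prop :=
  forall y, y \in U -> #|(S :&: (H :* y))%g| = b.

(** Such sets are the unions of double cosets of [H]. *)
Definition dstable (U : {set gT}) : Prop :=
  forall h k u, h \in H -> k \in H -> u \in U -> (h * u * k)%g \in U.

Lemma dstable_rcoset U y d :
  dstable U -> y \in U -> (d \in H :* y)%g -> d \in U.
Proof.
by move=> Ust yU /rcosetP[h hH ->]; rewrite -[(h * y)%g]mulg1; apply: Ust.
Qed.

Lemma dstable_lcoset U y d :
  dstable U -> y \in U -> (d \in y *: H)%g -> d \in U.
Proof.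
by move=> Ust yU /lcosetP[h hH ->]; rewrite -[y]mul1g; apply: Ust.
Qed.

Lemma dcoset_selection_sym (b : nat) (T : {set gT}) x :
    let D := (H :* x * H)%g in
    inv_closed D -> inv_closed T -> coset_regular 1 D T -> b <= #|H| ->
  exists S : {set gT}, [/\ S \subset D, inv_closed S & coset_regular b D S].
Proof.
move=> D DV TV T1 leb.
have Dst : dstable D by move=> h k u; apply: dcoset_stable.
have xD : x \in D := dcoset_refl x.
pose P := [set (H :* d)%g | d in D].
have inP d : d \in D -> (H :* d)%g \in P by move=> dD; apply/imsetP; exists d.
have P0 := inP x xD.
pose f d := enum_rank_in P0 (H :* d)%g.
have fE d y : d \in D -> y \in D -> (f d == f y) = (d \in H :* y)%g.
  move=> dD yD; rewrite (can_in_eq (enum_rankK_in P0)) ?inP //.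
  by apply/eqP/idP => [<-|/rcoset_eqP //]; rewrite rcoset_refl.
have f_surj i : exists2 y, y \in D & f y = i.
  have /imsetP[y yD yE] := enum_valP i.
  by exists y => //; rewrite /f -yE enum_valK_in.
have fiberE (S : {set gT}) y : S \subset D -> y \in D ->
    #|[set d in S | f d == f y]| = #|(S :&: (H :* y))%g|.
  move=> /subsetP sSD yD; apply: eq_card => d; rewrite !inE.
  by have [/sSD dD|//] := boolP (d \in S); rewrite fE.
pose m := #|((H :* x) :&: (x *: H))%g|.
pose arcs i j := [set d in D | (f d == i) && (f d^-1%g == j)].
(* If f y = i and f z = j, then [arcs i j] is the intersection of Hy and z^-1 H. *)
have arcsE i j : #|arcs i j| = m.
  have [y yD <-] := f_surj i; have [z zD <-] := f_surj j.
  have zVD : (z^-1)%g \in D by rewrite DV.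
  rewrite /m -(card_rcosetI_lcoset yD zVD); apply: eq_card => d; rewrite !inE.
  have [dD|dD] := boolP (d \in D); last first.
    by apply/esym/negP => /andP[/(dstable_rcoset Dst yD)]; rewrite (negPf dD).
  rewrite !fE ?DV // mem_lcoset invgK mem_rcoset /=; congr andb.
  by rewrite mem_rcoset -[in LHS]groupV invMg !invgK.
(* Sorting the elements d of Hx by the right coset of d^-1 gives #|P| classes of size [m]. *)
have nm : #|P| * m = #|H|.
  have cx : #|[set d in D | f d == f x]| = #|H|.
    rewrite fiberE // (setIidPr _) ?card_rcoset //.
    by apply/subsetP=> d; apply: dstable_rcoset.
  rewrite -cx -[RHS]sum1_card [RHS](partition_big (fun d => f d^-1%g) predT) //=.
  rewrite -[X in X * _ = _]card_ord -sum_nat_const.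
  apply: eq_bigr => j _; rewrite sum1_card -(arcsE (f x) j).
  by apply: eq_card => d; rewrite -[RHS]topredE /= !inE andbA.
pose loops := [exists t in D, t^-1 == t]%g.
have noinv (X : {set gT}) : X \subset D -> inv_closed X -> ~~ loops -> ~~ odd #|X|.
  move=> sXD XV; apply: contra => /(inv_closed_odd XV)[t tX tV].
  by apply/existsP; exists t; rewrite (subsetP sXD) //= tV.
have n0 : 0 < #|P| by apply/card_gt0P; exists (H :* x)%g; exact: P0.
have [||N [Nsym leN oddN sumN]] := @selection_matrix #|P| m b loops n0.
- by rewrite nm.
(* Inverse-closed subsets of [D] now have even size: the loops at one vertex number [m], and
   [T :&: D], with one point in each right coset, has size #|P|. *)
- move=> nl; rewrite -(arcsE (f x) (f x)); apply/andP; split; last first.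
    apply: noinv => //; first by apply/subsetP=> d; rewrite inE => /andP[].
    by move=> s; rewrite !inE DV invgK [X in _ && X]andbC.
  have -> : #|P| = #|T :&: D|.
    rewrite -[LHS]card_ord -[LHS]sum1_card -[RHS]sum1_card [RHS](partition_big f predT) //=.
    apply: eq_bigr => i _; have [y yD <-] := f_surj i.
    rewrite sum1_card -[LHS](T1 y yD); apply: eq_card => d.
    rewrite -[RHS]topredE /= !inE; have [dD|dD] := boolP (d \in D).
      by rewrite andbT fE.
    rewrite andbF; apply/negP => /andP[_ /(dstable_rcoset Dst yD)].
    by rewrite (negPf dD).
  by apply: noinv; rewrite ?subsetIr // => s; rewrite !in_setI TV DV.
have [|i|S [sSD SV cS]] := @symmetric_selection _ _ D f N DV Nsym.
- by move=> i j; rewrite (arcsE i j).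
- move=> /oddN/existsP[t /andP[tD /eqP tV]]; have [y yD <-] := f_surj i.
  (* An involution of [HxH] has an [H]-conjugate in every right coset. *)
  have /mem_dcoset[h [k [hH kH yE]]] := dcoset_trans tD yD.
  have tkD : (k^-1 * t * k)%g \in D by rewrite Dst ?groupV.
  exists (k^-1 * t * k)%g; split=> //; last by rewrite !invMg invgK tV mulgA.
  apply/eqP; rewrite fE // yE mem_rcoset !invMg !mulgA mulgK mulgK.
  by rewrite groupM ?groupV.
by exists S; split=> // y yD; rewrite -fiberE // cS sumN.
Qed.

(** Being inverse-closed, [T] also meets each left coset in [E] once. A set inside [D] that is
    regular for both left and right cosets is joined with its inverse, and disjointness of [D] and
    its inverse keeps the counts apart. *)
Lemma dcoset_selection_asym (b : nat) (T : {set gT}) x :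
    let D := (H :* x * H)%g in let E := D :|: (D^-1)%g in
    (x^-1)%g \notin D -> inv_closed T -> coset_regular 1 E T -> b <= #|H| ->
  exists S : {set gT}, [/\ S \subset E, inv_closed S & coset_regular b E S].
Proof.
move=> D E nxD TV T1 leb.
have Dst : dstable D by move=> h k u; apply: dcoset_stable.
have disD d : d \in D -> (d^-1)%g \in D -> False.
  case/mem_dcoset=> h [k [hH kH ->]] dVD; case/negP: nxD.
  suff -> : (x^-1 = k * (h * x * k)^-1 * h)%g by apply: Dst.
  by rewrite !invMg !mulgA mulgV mul1g mulgKV.
have EV : inv_closed E by move=> d; rewrite !in_setU !mem_invg invgK orbC.
have [B sBH cB] := subset_of_card leb.
pose S := ((T :&: D) * B)%g.
have sSD d : d \in S -> d \in D.
  case/mulsgP=> t h /setIP[_ tD] /(subsetP sBH) hH ->.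
  by rewrite -[t]mul1g; apply: Dst.
have Tl y : y \in E -> #|(T :&: (y *: H))%g| = 1.
  move=> yE; rewrite -[y]invgK -card_rcosetV (_ : T^-1 = T)%g ?T1 ?EV //.
  by apply/setP=> d; rewrite mem_invg.
(* Both t and u lie in the left coset of t h, so a factorization in [S] determines its factor in
   [T]. *)
have Tl_inj t u h k : t \in T -> u \in T -> t \in D -> h \in H -> k \in H ->
    (t * h = u * k)%g -> t = u.
  move=> tT uT tD hH kH eq; have tE : t \in E by rewrite in_setU tD.
  have /eqP/cards1P[v vE] := Tl t tE.
  have : t \in [set v] by rewrite -vE in_setI tT lcoset_refl.
  have : u \in [set v].
    by rewrite -vE in_setI uT mem_lcoset -(mulgK k u) -eq -mulgA mulKg groupM ?groupV.
  by rewrite !inE => /eqP-> /eqP->.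
have Sl y : y \in D -> #|(S :&: (y *: H))%g| = b.
  move=> yD; have yE : y \in E by rewrite in_setU yD.
  have /eqP/cards1P[t tE] := Tl y yE.
  have /setIP[tT ty] : t \in (T :&: (y *: H))%g by rewrite tE set11.
  have tD := dstable_lcoset Dst yD ty.
  rewrite -cB -(card_lcoset B t); apply: eq_card => d; rewrite in_setI.
  apply/andP/lcosetP => [[/mulsgP[u h /setIP[uT uD] hB ->] uhy]|[h hB ->]].
    have hH := subsetP sBH h hB.
    suff -> : t = u by exists h.
    apply/esym/set1P; rewrite -tE in_setI uT mem_lcoset.
    by rewrite -(groupMr _ hH) -mulgA -mem_lcoset.
  have hH := subsetP sBH h hB.
  split; first by apply: mem_mulg => //; rewrite in_setI tT.
  by rewrite mem_lcoset mulgA groupMr // -mem_lcoset.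
(* For h in [B], t h lies in Hy exactly when t lies in H y h^-1, which contains a single point
   [tau h] of [T]; hence [B] indexes the points of [S] in Hy. *)
have Sr y : y \in D -> #|(S :&: (H :* y))%g| = b.
  move=> yD; pose tau h := repr (T :&: (H :* (y * h^-1)))%g.
  have tauP h : h \in H -> tau h \in (T :&: (H :* (y * h^-1)))%g.
    move=> hH; have yhE : (y * h^-1)%g \in E.
      by rewrite in_setU -[y]mul1g Dst ?groupV.
    by have /eqP/cards1P[t tE] := T1 _ yhE; apply: (@mem_repr _ _ t); rewrite tE set11.
  have tauy h : h \in H -> (tau h * h)%g \in (H :* y)%g.
    by move=> hH; have /setIP[_] := tauP h hH; rewrite !mem_rcoset invMg invgK !mulgA.
  have tauD h : h \in H -> tau h \in D.
    move=> hH; have := dstable_rcoset Dst yD (tauy h hH).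
    by move/(Dst _ (h^-1)%g _ (group1 H)); rewrite groupV mul1g mulgK; apply.
  rewrite -cB -(card_in_imset (f := fun h => (tau h * h)%g) (D := B)); last first.
    move=> h k /(subsetP sBH) hH /(subsetP sBH) kH eq.
    have /setIP[hT _] := tauP h hH; have /setIP[kT _] := tauP k kH.
    have e := Tl_inj _ _ _ _ hT kT (tauD h hH) hH kH eq.
    by move: eq; rewrite e => /mulgI.
  apply: eq_card => d; rewrite in_setI.
  apply/andP/imsetP => [[/mulsgP[u h /setIP[uT uD] hB ->] uhy]|[h hB ->]].
    have hH := subsetP sBH h hB; exists h => //; congr (_ * _)%g.
    have yhE : (y * h^-1)%g \in E by rewrite in_setU -[y]mul1g Dst ?groupV.
    have /eqP/cards1P[t tE] := T1 _ yhE.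
    have := tauP h hH; rewrite tE => /set1P->; apply/set1P.
    by rewrite -tE in_setI uT mem_rcoset invMg invgK mulgA -mem_rcoset.
  have hH := subsetP sBH h hB; split; last exact: tauy.
  by apply: mem_mulg => //; rewrite in_setI tauD // andbT; case/setIP: (tauP h hH).
exists (S :|: S^-1)%g; split.
- apply/subsetP=> d; rewrite !in_setU !mem_invg.
  by case/orP=> /sSD ->; rewrite ?orbT.
- by move=> d; rewrite !in_setU !mem_invg invgK orbC.
have SVD d : d \in (S^-1)%g -> d \in D -> False.
  by rewrite mem_invg => /sSD dVD dD; apply: disD dVD.
move=> y; rewrite in_setU => /orP[yD|].
  rewrite -(Sr y yD) setIUl; congr #|pred_of_set _|;
  apply/setUidPl/subsetP=> d /setIP[dS].
  by move/(dstable_rcoset Dst yD)/(SVD d dS).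
(* On the inverse of [D], right-coset counts of S^-1 are left-coset counts of [S]. *)
rewrite mem_invg => yD.
rewrite -(Sl _ yD) -card_rcosetV setIUl; congr #|pred_of_set _|;
  apply/setUidPr/subsetP=> d /setIP[dS].
have dD := sSD d dS.
rewrite mem_rcoset -groupV invMg invgK => ydH.
exfalso; apply: (disD d dD); apply: (dstable_lcoset Dst yD).
by rewrite mem_lcoset invgK.
Qed.

(** Induction on #|U|: HxH and Hx^-1 H together form an inverse-closed union [E] of double cosets,
    so [U :\: E] inherits the hypotheses. No right coset meets both pieces, so the two selections
    can be joined. *)
Lemma coset_selection (b : nat) (U T : {set gT}) :
    inv_closed U -> dstable U -> inv_closed T -> coset_regular 1 U T -> b <= #|H| ->
  exists S : {set gT}, [/\ S \subset U, inv_closed S & coset_regular b U S].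
Proof.
move=> UV Ust TV T1 leb; have [c] := ubnP #|U|; elim: c => // c IH in U UV Ust T1 *.
rewrite ltnS => leU; have [U0|[x xU]] := set_0Vmem U.
  by exists set0; split=> [||y]; rewrite ?sub0set ?U0 ?inE // => s; rewrite !inE.
pose D := (H :* x * H)%g; pose E := D :|: (D^-1)%g.
have Dst : dstable D by move=> h k u; apply: dcoset_stable.
have xD : x \in D := dcoset_refl x.
have sDU d : d \in D -> d \in U by case/mem_dcoset=> h [k [hH kH ->]]; apply: Ust.
have sEU : E \subset U.
  by apply/subsetP=> d; rewrite in_setU mem_invg => /orP[|] /sDU; rewrite ?UV.
have EV : inv_closed E by move=> d; rewrite !in_setU !mem_invg invgK orbC.
have Est : dstable E.
  move=> h k u hH kH; rewrite !in_setU !mem_invg => /orP[uD|uD].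
    by rewrite Dst.
  by apply/orP; right; rewrite !invMg mulgA Dst ?groupV.
have T1E : coset_regular 1 E T by move=> y yE; apply: T1; rewrite (subsetP sEU).
have [S1 [sS1 S1V S1b]] :
    exists S : {set gT}, [/\ S \subset E, inv_closed S & coset_regular b E S].
  have [xVD|xVD] := boolP ((x^-1)%g \in D); last exact: dcoset_selection_asym T1E leb.
  have DV : inv_closed D.
    have DVD d : d \in D -> (d^-1)%g \in D.
      by case/mem_dcoset=> h [k [hH kH ->]]; rewrite !invMg mulgA Dst ?groupV.
    by move=> d; apply/idP/idP => /DVD; rewrite ?invgK.
  have ED : E = D by apply/setP=> d; rewrite in_setU mem_invg DV orbb.
  by rewrite ED in T1E *; apply: dcoset_selection_sym T1E leb.
have U'V : inv_closed (U :\: E) by move=> d; rewrite !(in_setD) EV UV.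
have U'st : dstable (U :\: E).
  move=> h k u hH kH /setDP[uU uE]; rewrite in_setD Ust // andbT.
  apply: contra uE => /(Est h^-1 k^-1)%g; rewrite !groupV => /(_ hH kH).
  by rewrite !mulgA mulVg mul1g mulgK.
have [||S2 [sS2 S2V S2b]] := IH _ U'V U'st.
- by move=> y /setDP[yU _]; apply: T1.
- apply: leq_trans leU; apply: proper_card; apply/properP; split; first exact: subsetDl.
  by exists x => //; rewrite in_setD in_setU xD.
exists (S1 :|: S2); split.
- by rewrite subUset (subset_trans sS1 sEU) (subset_trans sS2 (subsetDl _ _)).
- by move=> d; rewrite !in_setU S1V S2V.
move=> y yU; rewrite setIUl; have [yE|yE] := boolP (y \in E).
  rewrite -(S1b y yE); congr #|pred_of_set _|;
  apply/setUidPl/subsetP=> d /setIP[/(subsetP sS2)].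
  by case/setDP=> _ /negP dE /(dstable_rcoset Est yE).
have yU' : y \in U :\: E by rewrite in_setD yE.
rewrite -(S2b y yU'); congr #|pred_of_set _|;
  apply/setUidPr/subsetP=> d /setIP[/(subsetP sS1) dE].
by move/(dstable_rcoset U'st yU')/setDP=> [_ /negP].
Qed.

End DoubleCosets.

(** * Cayley graphs in terms of coset counts *)

Lemma card_cayley_nbhd (gT : finGroupType) (H : {group gT}) (S : {set gT}) (x : gT) :
  #|[set y in H | cayley S x y]| = #|(S :&: (H :* x^-1))%g|.
Proof.
rewrite -[LHS](card_rcoset _ x^-1%g); apply: eq_card => d.
by rewrite mem_rcoset inE in_setI mem_rcoset invgK andbC /cayley mulgK.
Qed.

Theorem theoremA (gT : finGroupType) (G H : {group gT})
    (sHG : H \subset G) (ntH : H :!=: 1%g) :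
  group_perfect_code G H <->
  (forall a b : nat,
     a <= #|H| - 1 -> b <= #|H| -> gcdn 2 (#|H| - 1) %| a ->
     group_regular_set G a b H).
Proof.
have H1 : 1 < #|H| by rewrite cardG_gt1.
(* The converse is the case a = 0, b = 1. *)
split=> [[T [[sTG TV] [_ _ Tout]]] a b lea leb dva|]; last by apply; rewrite ?dvdn0 // ltnW.
pose U := G :\: H.
have UV : inv_closed U by move=> s; rewrite !inE !groupV.
have Ust : dstable H U.
  move=> h k u hH kH /setDP[uG uH]; rewrite in_setD groupMr // groupMl // uH.
  exact: groupM (groupM (subsetP sHG h hH) uG) (subsetP sHG k kH).
have TI : inv_closed T by move=> s; apply/idP/idP => /TV; rewrite ?invgK.
have T1 : coset_regular H 1 U T.
  move=> y yU; rewrite -[y]invgK -card_cayley_nbhd; apply: Tout.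
  by rewrite UV.
have [S [sSU SV Sb]] := coset_selection UV Ust TI T1 leb.
have cH : #|H :\ 1%g| = #|H| - 1 by rewrite (cardsD1 1%g H) group1 addKn.
have HV : inv_closed (H :\ 1%g) by move=> s; rewrite !inE groupV invg_eq1.
have [||A [sA AV cA]] := @inv_closed_subset _ a (H :\ 1%g) HV.
- by rewrite cH.
(* An odd [a] is not divisible by 2, so |H| - 1 is odd and [H :\ 1%g] contains an involution. *)
- move=> oa; apply: inv_closed_odd => //; rewrite cH; apply: contraLR oa => ev.
  by move: dva; rewrite (gcdn_idPl _) ?dvdn2.
have sAH : A \subset H by apply: subset_trans sA (subsetDl _ _).
exists (A :|: S); split; first split.
- rewrite subUset (subset_trans sA) ?setSD //=; apply: subset_trans sSU _.
  by apply: setDS; rewrite sub1set group1.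
- by move=> s; rewrite !in_setU AV SV.
(* For x in [H] the coset Hx^-1 is [H] and meets only [A]; for x outside it meets only [S]. *)
split=> // x xG; rewrite card_cayley_nbhd setIUl.
  rewrite rcoset_id ?groupV // (setIidPl sAH) -[RHS]cA; congr #|pred_of_set _|; apply/setUidPl.
  by apply/subsetP=> d /setIP[/(subsetP sSU)/setDP[_ /negP]].
have xVU : (x^-1)%g \in U by rewrite UV.
rewrite -(Sb _ xVU); congr #|pred_of_set _|;
  apply/setUidPr/subsetP=> d /setIP[/(subsetP sAH) dH].
by move/(dstable_rcoset Ust xVU)/setDP => [_ /negP].
Qed.
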